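(* Let player $B$ use a memory-limited count-based learning rule $f_m$ with memory length $m\ge1$ in a $T$-round repeated game. Consider the dynamic program with table $V$ indexed by a time step $t$ and a sequence of the last $\min(m,t)$ actions of player $A$ (ordered from least to most recent), defined by $$V[1,[x_1]]=\bar u^A(x_1,f_m([\,]))\quad (x_1\in\mathcal{A}),$$ for $1<t\le m$: $$V[t,[x_1,\dots,x_t]]=V[t-1,[x_1,\dots,x_{t-1}]]+\bar u^A\big(x_t,f_m([x_1,\dots,x_{t-1}])\big),$$ and for $t>m$: $$V[t,[x_1,\dots,x_m]]=\max_{a\in\mathcal{A}}\Big[V[t-1,[a,x_1,\dots,x_{m-1}]]+\bar u^A\big(x_m,f_m([a,x_1,\dots,x_{m-1}])\big)\Big].$$ Then the maximum entry of $V$ with $t=T$ equals the maximum expected cumulative payoff of player $A$ over $T$ rounds against $f_m$, and the dynamic program runs in time $O(k_A^{m+2}k_BT)$. An optimal sequence of actions is recovered via an auxiliary array that stores, for each table entry, a sequence achieving the payoff in that entry.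
   Context: Setting. A two-player normal-form game is repeated for $T$ rounds. Player $A$ (the optimizer) has actions $\mathcal{A}=\{a_1,\dots,a_{k_A}\}$, player $B$ (the opponent) has actions $\mathcal{B}=\{b_1,\dots,b_{k_B}\}$, with utilities $u^A,u^B:\mathcal{A}\times\mathcal{B}\to\mathbb{R}$. For $a\in\mathcal{A}$ and $\beta\in\Delta(\mathcal{B})$ (mixed actions of $B$), $\bar u^A(a,\beta)=\sum_{j=1}^{k_B}\beta(b_j)u^A(a,b_j)$. A memory-limited count-based learning rule $f_m$ with memory $m$ maps count vectors $(c_1,\dots,c_{k_A})\in\mathbb{N}^{k_A}$ with $\sum_ic_i\le m$ to $\Delta(\mathcal{B})$: in round $t$, player $B$ plays $f_m(c_1,\dots,c_{k_A})$, where $c_i$ is the number of times $A$ played $a_i$ in the last $\min(m,t-1)$ rounds. For a sequence of at most $m$ actions, $f_m([x_1,\dots,x_j])$ means $f_m$ applied to the counts of the listed actions ($f_m([\,])$ for the empty history). The expected cumulative payoff of $x_1,\dots,x_T\in\mathcal{A}$ is $\sum_{t=1}^T\bar u^A(x_t,f_m([x_{\max(1,t-m)},\dots,x_{t-1}]))$. Computational convention: given a count vector, the output of $f_m$ can be computed in $O(k_Ak_B)$ time; arithmetic operations take unit time. *)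

(* Defs.v *)
From HB Require Import structures.
From mathcomp Require Import all_boot all_order all_algebra.
From mathcomp Require Import reals.

Set Implicit Arguments.
Unset Strict Implicit.
Unset Printing Implicit Defensive.

Import Order.TTheory GRing.Theory Num.Theory.
Local Open Scope ring_scope.

Record game (R : realType) (kA kB : nat) := Game {
  uA : 'I_kA -> 'I_kB -> R;
  uB : 'I_kA -> 'I_kB -> R }.

Record mixed (R : realType) (kB : nat) := Mixed {
  mixed_fun :> 'I_kB -> R;
  mixed_ge0 : forall j, 0 <= mixed_fun j;
  mixed_sum1 : \sum_(j < kB) mixed_fun j = 1 }.

Definition ubarA (R : realType) kA kB (g : game R kA kB) (a : 'I_kA)
    (beta : mixed R kB) : R :=
  \sum_(j < kB) beta j * uA g a j.

Definition count_vec (kA m : nat) :=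
  {c : {ffun 'I_kA -> nat} | (\sum_i c i <= m)%N}.

Definition count_rule (R : realType) (kA kB m : nat) :=
  count_vec kA m -> mixed R kB.

Fact zero_count_subproof (kA m : nat) :
  (\sum_i ([ffun=> 0%N] : {ffun 'I_kA -> nat}) i <= m)%N.
Proof. by rewrite big1 // => i _; rewrite ffunE. Qed.

Definition zero_count (kA m : nat) : count_vec kA m :=
  exist _ [ffun=> 0%N] (zero_count_subproof kA m).

(* The default [zero_count] only concerns functions that are not count vectors
   of total at most [m]. *)
Definition to_count_vec (kA m : nat) (c : 'I_kA -> nat) : count_vec kA m :=
  insubd (zero_count kA m) (finfun c).

(* [f [x_1, ..., x_j]], meaningful for j <= m. *)
Definition play (R : realType) kA kB m (f : count_rule R kA kB m)
    (s : seq 'I_kA) : mixed R kB :=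
  f (to_count_vec m (fun i => count_mem i s)).

(* The index [t] is one less than the round number: [take t x] is the history
   before the round in which [tnth (in_tuple x) t] is played, and
   [drop (t - m)] keeps its last [minn m t] actions. *)
Definition payoff (R : realType) kA kB m (g : game R kA kB)
    (f : count_rule R kA kB m) (x : seq 'I_kA) : R :=
  \sum_(t < size x)
     ubarA g (tnth (in_tuple x) t) (play f (drop (t - m) (take t x))).

Definition is_max_of (R : realType) (I : Type) (F : I -> R) (v : R) : Prop :=
  (exists i, F i = v) /\ (forall i, F i <= v).

(* Sequences are listed from least to most recent; only the entries [V t s] with
   1 <= t <= T and [size s = minn m t] are constrained. *)
Record dp_table (R : realType) kA kB m (T : nat) (g : game R kA kB)
    (f : count_rule R kA kB m) (V : nat -> seq 'I_kA -> R) : Prop := DPTable {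
  dp_first : forall x : 'I_kA, V 1%N [:: x] = ubarA g x (play f [::]);
  dp_grow : forall (t : nat) (s : seq 'I_kA) (x : 'I_kA),
    (1 < t <= m)%N -> (t <= T)%N -> size s = t.-1 ->
    V t (rcons s x) = V t.-1 s + ubarA g x (play f s);
  dp_slide : forall (t : nat) (s : seq 'I_kA) (x : 'I_kA),
    (m < t <= T)%N -> size s = m.-1 ->
    is_max_of
      (fun a : 'I_kA => V t.-1 (a :: s) + ubarA g x (play f (a :: s)))
      (V t (rcons s x)) }.

(* Cost model.  A program is a value together with the number of steps used to
   obtain it.  A step is one arithmetic operation or comparison (on naturals or
   reals), one array read or write, one list cons, or one loop iteration; one
   evaluation of the learning rule is charged separately.  Arrays are functional
   but used single-threadedly, as mutable arrays of a unit-cost RAM; a fresh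
   array has arbitrary contents and costs nothing until it is written. *)
Record timed (A : Type) := Timed { result : A; steps : nat }.

Definition ret A (v : A) : timed A := Timed v 0.

Definition bind A B (p : timed A) (k : A -> timed B) : timed B :=
  let q := k (result p) in Timed (result q) (steps p + steps q).

Definition tick A (v : A) : timed A := Timed v 1.

Notation "'let*' x := e 'in' k" := (bind e (fun x => k))
  (at level 200, x name, right associativity,
   format "'[v' 'let*'  x  :=  e  'in' '/' k ']'").

Fixpoint loop (I S : Type) (r : seq I) (body : I -> S -> timed S) (s : S) :
    timed S :=
  if r is i :: r' then
    let* s0 := tick s in
    let* s1 := body i s0 in
    loop r' body s1
  else ret s.

Definition array (I A : Type) := I -> A.

Definition get (I A : Type) (a : array I A) (i : I) : timed A := tick (a i).

Definition set (I : eqType) (A : Type) (a : array I A) (i : I) (v : A) :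
    timed (array I A) :=
  tick (fun j => if j == i then v else a j).

(* The loop accumulator for a maximum over a nonempty range: the best value so
   far with its label, [None] before the first candidate. *)
Definition keep_max (R : realType) A (best : option (R * A)) (v : R) (x : A) :
    timed (option (R * A)) :=
  let* b := tick (if best is Some (w, _) then w < v else true) in
  ret (if b then Some (v, x) else best).

(* An action sequence is addressed by its base-[kA] code, the least recent
   action being the most significant digit: appending [x] to code [p] gives
   [p * kA + x], prepending [a] to a code [q] of length l gives
   [a * kA ^ l + q]. *)
Definition code (kA : nat) (s : seq 'I_kA) : nat :=
  foldl (fun c (x : 'I_kA) => (c * kA + x)%N) 0%N s.

(* The entries of the table and of the auxiliary array for one time step.  A
   stored action sequence is a linked list with the most recent action first, so
   that extending it is a single cons. *)
Record layer (R : realType) (kA : nat) := Layer {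
  lval : array nat R;
  lseq : array nat (seq 'I_kA) }.

Definition no_layer (R : realType) (kA : nat) : layer R kA :=
  Layer (fun=> 0) (fun=> [::]).

(* After step [t], with l = minn m t: [counts] holds the count vector of each
   sequence of length l and [width] is kA ^ l.-1. *)
Record dp_state (R : realType) (kA : nat) := DPState {
  layers : array nat (layer R kA);
  counts : array nat (array 'I_kA nat);
  width : nat }.

Section Program.
Variables (R : realType) (kA kB m : nat) (g : game R kA kB).
Variables (f : count_rule R kA kB m) (tau : count_vec kA m -> nat).

Definition query (c : array 'I_kA nat) : timed (mixed R kB) :=
  Timed (f (to_count_vec m c)) (tau (to_count_vec m c)).

Definition stage_payoff (x : 'I_kA) (c : array 'I_kA nat) : timed R :=
  let* beta := query c in
  loop (enum 'I_kB) (fun j acc =>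
    let* p := get beta j in
    let* u := tick (uA g x j) in
    let* pu := tick (p * u) in
    tick (acc + pu)) 0.

Definition empty_count : timed (array 'I_kA nat) :=
  loop (enum 'I_kA) (fun i c => set c i 0%N) (fun=> 0%N).

Definition push_count (c : array 'I_kA nat) (x : 'I_kA) :
    timed (array 'I_kA nat) :=
  let* d := loop (enum 'I_kA) (fun i d =>
    let* n := get c i in
    set d i n) (fun=> 0%N) in
  let* n := get d x in
  let* n' := tick n.+1 in
  set d x n'.

Definition put (L : layer R kA) (i : nat) (v : R) (h : seq 'I_kA) :
    timed (layer R kA) :=
  let* V := set (lval L) i v in
  let* H := set (lseq L) i h in
  ret (Layer V H).

Definition first_step : timed (dp_state R kA) :=
  let* c0 := empty_count in
  let* LC := loop (enum 'I_kA) (fun x LC =>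
    let* v := stage_payoff x c0 in
    let* h := tick [:: x] in
    let* L := put LC.1 x v h in
    let* c := push_count c0 x in
    let* C := set LC.2 (x : nat) c in
    ret (L, C)) (no_layer R kA, fun=> fun=> 0%N) in
  let* tab := set (fun=> no_layer R kA) 1%N LC.1 in
  ret (DPState tab LC.2 1).

Definition grow_step (t : nat) (s : dp_state R kA) : timed (dp_state R kA) :=
  let* t1 := tick t.-1 in
  let* P := get (layers s) t1 in
  let* w := tick (width s * kA)%N in
  let* LC := loop (iota 0 w) (fun p => loop (enum 'I_kA) (fun x LC =>
    let* v0 := get (lval P) p in
    let* h0 := get (lseq P) p in
    let* c0 := get (counts s) p in
    let* u := stage_payoff x c0 in
    let* v := tick (v0 + u) in
    let* h := tick (x :: h0) in
    let* r := tick (p * kA)%N in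
    let* i := tick (r + x)%N in
    let* L := put LC.1 i v h in
    let* c := push_count c0 x in
    let* C := set LC.2 i c in
    ret (L, C))) (no_layer R kA, fun=> fun=> 0%N) in
  let* tab := set (layers s) t LC.1 in
  ret (DPState tab LC.2 w).

Definition slide_step (t : nat) (s : dp_state R kA) : timed (dp_state R kA) :=
  let* t1 := tick t.-1 in
  let* P := get (layers s) t1 in
  let* L := loop (iota 0 (width s)) (fun q => loop (enum 'I_kA) (fun x L =>
    let* best := loop (enum 'I_kA) (fun a best =>
      let* r := tick (a * width s)%N in
      let* p := tick (r + q)%N in
      let* v0 := get (lval P) p in
      let* h0 := get (lseq P) p in
      let* c0 := get (counts s) p in
      let* u := stage_payoff x c0 in
      let* v := tick (v0 + u) in
      keep_max best v h0) None in
    if best is Some (v, h0) then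
      let* h := tick (x :: h0) in
      let* r := tick (q * kA)%N in
      let* i := tick (r + x)%N in
      put L i v h
    else ret L)) (no_layer R kA) in
  let* tab := set (layers s) t L in
  ret (DPState tab (counts s) (width s)).

Definition fill_table (T : nat) : timed (dp_state R kA) :=
  let* s1 := first_step in
  loop (iota 2 T.-1) (fun t s =>
    let* b := tick (t <= m)%N in
    if b then grow_step t s else slide_step t s) s1.

Definition best_entry (T : nat) (s : dp_state R kA) :
    timed (option (R * seq 'I_kA)) :=
  let* P := get (layers s) T in
  let* w := tick (width s * kA)%N in
  let* best := loop (iota 0 w) (fun i best =>
    let* v := get (lval P) i in
    keep_max best v i) None in
  if best is Some (v, i) then
    let* h := get (lseq P) i in
    let* x := loop h (fun a x => tick (a :: x)) [::] in
    ret (Some (v, x))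
  else ret None.

(* The filled tables, then the largest entry for [t = T] with the action
   sequence stored for it, in chronological order. *)
Definition solve (T : nat) :
    timed (dp_state R kA * option (R * seq 'I_kA)) :=
  let* s := fill_table T in
  let* o := best_entry T s in
  ret (s, o).

End Program.

Definition table_entry (R : realType) kA (s : dp_state R kA) (t : nat)
    (h : seq 'I_kA) : R :=
  lval (layers s t) (code h).

Definition aux_entry (R : realType) kA (s : dp_state R kA) (t : nat)
    (h : seq 'I_kA) : seq 'I_kA :=
  rev (lseq (layers s t) (code h)).

(* Main.v *)
(* The payoff of a round depends only on the action played and on the last
   [m] actions.  Hence [V t h] is the largest payoff of a sequence of length [t]
   whose last [minn m t] actions are [h]: the action that leaves the window when
   the round is appended is unknown, and the recursion maximizes over it.  The
   program writes each entry of a layer at the base-[kA] code of its sequence;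
   the written value depends on the address only, so an entry is correct as soon
   as it has been written once.  A layer has at most [kA ^ m] entries, each a
   maximum over [kA] candidates that cost O(kA * kB) apiece. *)

Require Import Defs.
From HB Require Import structures.
From mathcomp Require Import all_boot all_order all_algebra.
From mathcomp Require Import reals.
From mathcomp Require Import zify.

Set Implicit Arguments.
Unset Strict Implicit.
Unset Printing Implicit Defensive.

Import Order.TTheory GRing.Theory Num.Theory.
Local Open Scope ring_scope.

(** * Loops: final state, cost bound and invariants *)

Section Loops.
Variables (I : eqType) (S : Type).
Implicit Types (r : seq I) (body : I -> S -> timed S) (s : S).

Lemma result_loop r body s :
  result (loop r body s) = foldl (fun s i => result (body i s)) s r.
Proof. by elim: r s => //= i r IHr s; rewrite IHr. Qed.

(** Peels off the last iteration, whereas [loop] recurses on the first; inductions on the number of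
    rounds or on a growing range of candidates need this form. *)
Lemma loop_rcons r i body s :
  let s' := result (loop r body s) in
  result (loop (rcons r i) body s) = result (body i s') /\
  steps (loop (rcons r i) body s) =
    (steps (loop r body s) + (steps (body i s')).+1)%N.
Proof.
split; first by rewrite !result_loop foldl_rcons.
by elim: r s => [|j r IHr] s /=; rewrite ?IHr /=; lia.
Qed.

Lemma steps_loop_le r body s (c : nat) :
  (forall i s, (steps (body i s) <= c)%N) ->
  (steps (loop r body s) <= size r * c.+1)%N.
Proof.
move=> bodyP; elim: r s => //= i r IHr s.
have := IHr (result (body i s)); have := bodyP i s; rewrite /= mulSn; lia.
Qed.

Lemma loop_stable (P : S -> Prop) r body s :
  P s -> (forall i s, i \in r -> P s -> P (result (body i s))) ->
  P (result (loop r body s)).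
Proof.
move=> Ps bodyP; rewrite result_loop.
elim: r s Ps bodyP => //= i r IHr s Ps bodyP; apply: IHr.
  by apply: bodyP => //; rewrite mem_head.
by move=> j s' rj; apply: bodyP; rewrite inE rj orbT.
Qed.

(* For loops of array writes [P] says that a given cell holds its final value:
   no distinctness of the addresses is needed. *)
Lemma loop_reach (P : S -> Prop) r i0 body s :
  i0 \in r -> (forall s, P (result (body i0 s))) ->
  (forall i s, i \in r -> P s -> P (result (body i s))) ->
  P (result (loop r body s)).
Proof.
rewrite result_loop; elim: r s => //= i r IHr s.
rewrite inE => ri0 P0 bodyP.
have bodyP' j s' : j \in r -> P s' -> P (result (body j s')).
  by move=> rj; apply: bodyP; rewrite inE rj orbT.
have [r0|/negPf r0] := boolP (i0 \in r); first exact: IHr.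
move: ri0; rewrite r0 orbF => /eqP <-; rewrite -result_loop.
exact: loop_stable.
Qed.

End Loops.

(** Induction from the right compares the running best with one new candidate. A one-element range
    is treated apart, because the accumulator is then still [None]. *)
Lemma loop_keep_max (R : realType) (I : eqType) (A : Type) (r : seq I)
    (body : I -> option (R * A) -> timed (option (R * A)))
    (F : I -> R) (G : I -> A) :
  (forall i b, result (body i b) = result (keep_max b (F i) (G i))) ->
  (exists i, i \in r) ->
  exists i, [/\ i \in r, result (loop r body None) = Some (F i, G i)
              & forall j, j \in r -> F j <= F i].
Proof.
move=> bodyP; elim/last_ind: r => [[]//|r k IHr _].
rewrite (loop_rcons _ _ _ _).1 bodyP.
case: r IHr => [_|i0 r IHr].
  by exists k; split=> // [|j]; rewrite inE // => /eqP->.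
case: IHr => [|i]; first by exists i0; rewrite mem_head.
move: {i0 r}(i0 :: r) => r [ri -> maxi]; rewrite /keep_max /=; case: ltP => [lt_ik|le_ki].
  exists k; split=> // [|j]; rewrite mem_rcons inE ?eqxx //.
  by case/predU1P=> [->//|/maxi/le_trans]; apply; apply: ltW.
exists i; split=> // [|j]; rewrite mem_rcons inE ?ri ?orbT //.
by case/predU1P=> [->//|/maxi].
Qed.

(** * Base-[kA] codes of action sequences *)

Section Code.
Variable kA : nat.
Implicit Types (h : seq 'I_kA) (x : 'I_kA).

Lemma code_rcons h x : code (rcons h x) = (code h * kA + x)%N.
Proof. by rewrite /code foldl_rcons. Qed.

Lemma code_cons x h : code (x :: h) = (x * kA ^ size h + code h)%N.
Proof.
elim/last_ind: h => [|h y IHh]; first by rewrite /code /= muln1 addn0.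
by rewrite -rcons_cons !code_rcons IHh size_rcons expnSr; lia.
Qed.

Lemma code_lt h : (code h < kA ^ size h)%N.
Proof.
elim/last_ind: h => [|h x IHh]; first by [].
rewrite code_rcons size_rcons expnSr.
have := leq_mul IHh (leqnn kA); have := ltn_ord x; lia.
Qed.

(** Division by [kA] gives the code of the prefix, and the remainder is the last action. With
    [code_lt], a scan of the addresses below [kA ^ l] is a scan of all sequences of length [l]. *)
Lemma code_surj l i : (i < kA ^ l)%N -> exists2 h : seq 'I_kA, size h = l & code h = i.
Proof.
elim: l i => [|l IHl] i; first by case: i => // _; exists [::].
rewrite expnSr => lt_i.
have kA_gt0 : (0 < kA)%N by case: (kA) lt_i => //; rewrite muln0.
have [|h sz_h code_h] := IHl (i %/ kA)%N; first by rewrite ltn_divLR.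
exists (rcons h (Ordinal (ltn_pmod i kA_gt0))).
  by rewrite size_rcons sz_h.
by rewrite code_rcons code_h /= -divn_eq.
Qed.

(** Uniqueness of quotient and remainder: a write at [q * kA + y] reaches the cell of the pair (p,
    x) only if it comes from that pair. *)
Lemma digit_inj (p q : nat) (x y : 'I_kA) : (p * kA + x = q * kA + y)%N -> p = q /\ x = y.
Proof.
have kA_gt0 : (0 < kA)%N by apply: leq_ltn_trans (ltn_ord x).
move=> e; split.
  have := congr1 (divn^~ kA) e.
  by rewrite !divnMDl // !divn_small // !addn0.
have := congr1 (modn^~ kA) e.
by rewrite !modnMDl !modn_small // => /val_inj.
Qed.

End Code.

Lemma is_max_of_exists (R : realType) (I : finType) (F : I -> R) (i0 : I) :
  exists v, is_max_of F v.
Proof.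
case: (@arg_maxP _ _ _ i0 predT F isT) => i _ maxi.
by exists (F i); split=> [|j]; [exists i | apply: maxi].
Qed.

(** * The recursion as a maximum over sequences with a given window *)

Section DynamicProgram.
Variables (R : realType) (kA kB m : nat) (g : game R kA kB).
Variable f : count_rule R kA kB m.
Hypothesis m_gt0 : (0 < m)%N.

Lemma payoff_nil : payoff g f [::] = 0.
Proof. by rewrite /payoff big_ord0. Qed.

(** The payoff of a round depends only on the actions up to it, so appending an action leaves the
    earlier terms unchanged. *)
Lemma payoff_rcons y x :
  payoff g f (rcons y x) =
    payoff g f y + ubarA g x (play f (drop (size y - m) y)).
Proof.
rewrite /payoff.
under eq_bigr => t _ do rewrite (tnth_nth x) /=.
under [in RHS]eq_bigr => t _ do rewrite (tnth_nth x) /=.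
rewrite size_rcons big_ord_recr /= nth_rcons ltnn eqxx -cats1 take_size_cat //.
congr (_ + _); apply: eq_bigr => t _.
by rewrite nth_cat ltn_ord take_cat ltn_ord.
Qed.

(** Induction on [t]. Attainment extends an optimal sequence of the maximizing predecessor window;
    the bound removes the last action of a sequence and compares with the predecessor window that
    this leaves. *)
Lemma dp_table_max T V : dp_table T g f V ->
  forall t h, (0 < t <= T)%N -> size h = minn m t ->
  (exists y, [/\ size y = t, drop (t - m) y = h & payoff g f y = V t h]) /\
  (forall y, size y = t -> drop (t - m) y = h -> payoff g f y <= V t h).
Proof.
move=> VP; elim=> // -[_|t IHt] h /andP[_ le_tT] sz_h.
  have e1 : (1 - m = 0)%N by lia.
  have {sz_h} : size h = 1%N by lia.
  rewrite e1; case: h => [|x []] // _.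
  have e : payoff g f [:: x] = V 1%N [:: x].
    by rewrite (payoff_rcons [::]) payoff_nil add0r (dp_first VP).
  by split=> [|y _]; [exists [:: x]; rewrite drop0 | rewrite drop0 => ->; rewrite e].
have lt_tT : (0 < t.+1 <= T)%N by lia.
move: sz_h; case/lastP: h => [|s x]; first by rewrite /=; lia.
rewrite size_rcons => sz_s.
(* While the window holds the whole history, only one sequence is compatible with it, so attainment
   and bound reduce to one equality. *)
have [le_tm|lt_mt] := leqP t.+2 m.
  have e0 : (t.+2 - m = 0)%N by lia.
  have sz_s' : size s = t.+1 by lia.
  have [] := IHt s lt_tT; first by rewrite sz_s'; lia.
  have -> : (t.+1 - m = 0)%N by lia.
  move=> [_ [_ /[!drop0] -> e]] _.
  have {}e : payoff g f (rcons s x) = V t.+2 (rcons s x).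
    rewrite (dp_grow VP) ?sz_s' //= payoff_rcons e sz_s'.
    have -> : (t.+1 - m = 0)%N by lia.
    by rewrite drop0.
  rewrite e0; split=> [|y _]; last by rewrite drop0 => ->; rewrite e.
  by exists (rcons s x); rewrite drop0 size_rcons sz_s'.
have sz_s' : size s = m.-1 by lia.
have sz_as a : size (a :: s) = minn m t.+1 by rewrite /= sz_s'; lia.
have [[a Va] maxV] : is_max_of
      (fun a => V t.+1 (a :: s) + ubarA g x (play f (a :: s))) (V t.+2 (rcons s x)).
  by apply: (dp_slide VP (t := t.+2)); rewrite // lt_mt.
(* Here [m <= t.+1], so one more round makes the window lose its oldest action and gain [z]. *)
have dropS y : size y = t.+1 -> forall z,
    drop (t.+2 - m) (rcons y z) = rcons (behead (drop (t.+1 - m) y)) z.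
  move=> sz_y z; rewrite subSn // drop_rcons ?sz_y; last by lia.
  by rewrite -drop1 drop_drop add1n.
split.
  have [[y [sz_y dy py]] _] := IHt (a :: s) lt_tT (sz_as a).
  exists (rcons y x); rewrite size_rcons sz_y dropS // dy; split=> //.
  by rewrite payoff_rcons sz_y dy py Va.
case/lastP=> [//|y z]; rewrite size_rcons => -[sz_y].
rewrite dropS // => /rcons_inj[dy ->] {z}.
(* The window has [m >= 1] actions, hence an oldest one, [b]; it is the candidate at which the
   maximum is tested. *)
case dy' : (drop (t.+1 - m) y) dy => [|b s'] /=.
  by have := congr1 size dy'; rewrite size_drop sz_y /=; lia.
move=> es; rewrite {}es in dy'.
have [_ /(_ y sz_y dy') le_y] := IHt (b :: s) lt_tT (sz_as b).
rewrite payoff_rcons sz_y dy'; apply: le_trans (maxV b).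
by rewrite lerD2r.
Qed.

(** Every sequence of length [T] is bounded by the entry of its own last [minn m T] actions, and the
    largest entry is attained by some sequence. *)
Lemma dp_table_is_max T V v : (0 < T)%N -> dp_table T g f V ->
  is_max_of (fun h : (minn m T).-tuple 'I_kA => V T h) v ->
  is_max_of (fun x : T.-tuple 'I_kA => payoff g f x) v.
Proof.
move=> T_gt0 VP [[h <-] maxh].
have lTT : (0 < T <= T)%N by rewrite T_gt0 leqnn.
have [[y [/eqP sz_y _ py]] _] := dp_table_max VP lTT (size_tuple h).
split=> [|x]; first by exists (Tuple sz_y).
have sz_d : size (drop (T - m) x) == minn m T.
  by rewrite size_drop size_tuple; lia.
have [_ maxV] := dp_table_max VP lTT (eqP sz_d).
exact: le_trans (maxV _ (size_tuple x) erefl) (maxh (Tuple sz_d)).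
Qed.

End DynamicProgram.

(** * Effect of single program steps on the arrays *)

Section ProgramSteps.
Variables (R : realType) (kA kB m : nat) (g : game R kA kB).
Variables (f : count_rule R kA kB m) (tau : count_vec kA m -> nat).
Implicit Types (x a : 'I_kA) (c : array 'I_kA nat) (s : dp_state R kA).

Let gain x c : R := ubarA g x (f (to_count_vec m c)).

(** Count arrays are functions known only pointwise; [finfun] turns pointwise agreement into
    equality of the vectors given to the rule. *)
Lemma to_count_vec_ext c c' : c =1 c' -> to_count_vec m c = to_count_vec m c'.
Proof.
move=> e; rewrite /to_count_vec; congr insubd.
by apply/ffunP=> i; rewrite !ffunE.
Qed.

Lemma result_stage_payoff x c : result (stage_payoff g f tau x c) = gain x c.
Proof.
rewrite /stage_payoff /= result_loop /= /gain /ubarA -big_enum /=.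
(* The accumulator is generalized from 0 to [z], since the loop sums from the left and the big
   operator from the right. *)
rewrite -[RHS]add0r; elim: (enum _) {1 2}0 => [|j r IHr] z /=.
  by rewrite big_nil addr0.
by rewrite IHr big_cons addrA.
Qed.

Lemma result_empty_count i : result (empty_count kA) i = 0%N.
Proof.
by apply: (@loop_stable _ _ (fun c => c i = 0%N)) => // j c _ /=; case: ifP.
Qed.

Lemma result_push_count c x i :
  result (push_count c x) i = ((x == i) + c i)%N.
Proof.
rewrite /push_count /=.
have copy j : result (loop (enum 'I_kA) (fun i d =>
    let* n := get c i in Defs.set d i n) (fun=> 0%N)) j = c j.
  apply: (@loop_reach _ _ (fun d => d j = c j) _ j) => [||k d _ /=].
  - by rewrite mem_enum.
  - by move=> d /=; rewrite eqxx.
  - by case: eqP => [->|].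
by rewrite copy eq_sym; case: eqP => [->|_]; rewrite ?copy.
Qed.

Lemma layers_first_step x :
  let st := result (first_step g f tau) in
  [/\ lval (layers st 1) x = gain x (fun=> 0%N),
      lseq (layers st 1) x = [:: x],
      forall i, counts st x i = (x == i) :> nat
    & width st = 1%N].
Proof.
rewrite /first_step /=.
set l := loop _ _ _.
suff [e1 e2 e3] : [/\ lval (result l).1 x = gain x (fun=> 0%N),
    lseq (result l).1 x = [:: x]
    & forall i, (result l).2 x i = (x == i) :> nat] by [].
rewrite /l; apply: (@loop_reach _ _ (fun LC : layer R kA * _ =>
    [/\ lval LC.1 x = gain x (fun=> 0%N), lseq LC.1 x = [:: x]
      & forall i, LC.2 (x : nat) i = (x == i) :> nat]) _ x).
- by rewrite mem_enum.
- move=> LC /=; rewrite !eqxx result_stage_payoff; split=> // [|i].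
    by rewrite /gain (to_count_vec_ext result_empty_count).
  by apply: etrans (result_push_count _ _ _) _; rewrite result_empty_count addn0.
- move=> y LC _ [e1 e2 e3] /=; case: eqP => // /val_inj <-.
  rewrite result_stage_payoff; split=> // [|i].
    by rewrite /gain (to_count_vec_ext result_empty_count).
  by apply: etrans (result_push_count _ _ _) _; rewrite result_empty_count addn0.
Qed.

Lemma grow_step_other t s u :
  u != t -> layers (result (grow_step g f tau t s)) u = layers s u.
Proof. by move=> /negPf /= ->. Qed.

Lemma grow_step_new t s p x : (p < width s * kA)%N ->
  let s' := result (grow_step g f tau t s) in
  let L := layers s t.-1 in
  let i := (p * kA + x)%N in
  [/\ lval (layers s' t) i = lval L p + gain x (counts s p),
      lseq (layers s' t) i = x :: lseq L p
    & forall j, counts s' i j = ((x == j) + counts s p j)%N].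
Proof.
move=> lt_p; rewrite /grow_step /= eqxx.
set l := loop _ _ _.
pose Q (LC : layer R kA * array nat (array 'I_kA nat)) :=
  [/\ lval LC.1 (p * kA + x)%N = lval (layers s t.-1) p + gain x (counts s p),
      lseq LC.1 (p * kA + x)%N = x :: lseq (layers s t.-1) p
    & forall j, LC.2 (p * kA + x)%N j = ((x == j) + counts s p j)%N].
suff: Q (result l) by case.
(* A write either misses the cell or, by [digit_inj], comes from the pair (p, x) and stores the same
   contents again. *)
have Qbody q y LC : Q LC -> Q (result (
    let* v0 := get (lval (layers s t.-1)) q in
    let* h0 := get (lseq (layers s t.-1)) q in
    let* c0 := get (counts s) q in
    let* u := stage_payoff g f tau y c0 in
    let* v := tick (v0 + u) in
    let* h := tick (y :: h0) in
    let* r := tick (q * kA)%N in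
    let* i := tick (r + y)%N in
    let* L := put LC.1 i v h in
    let* c := push_count c0 y in
    let* C := Defs.set LC.2 i c in
    ret (L, C))).
  rewrite /Q /= => -[e1 e2 e3]; case: eqP => // /digit_inj[<- <-].
  by rewrite result_stage_payoff; split=> // i; apply: result_push_count.
rewrite /l; apply: (@loop_reach _ _ Q _ p).
- by rewrite mem_iota.
- move=> LC; apply: (@loop_reach _ _ Q _ x) => [||y LC' _].
  + by rewrite mem_enum.
  + move=> LC' /=; rewrite /Q /= !eqxx result_stage_payoff.
    by split=> // i; apply: result_push_count.
  + exact: Qbody.
- by move=> q LC _ QLC; apply: loop_stable => // y LC' _; apply: Qbody.
Qed.

Lemma slide_step_other t s u :
  u != t -> layers (result (slide_step g f tau t s)) u = layers s u.
Proof. by move=> /negPf /= ->. Qed.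

(** A single maximizer [a] accounts for both the stored value and the stored sequence, which keeps
    the two arrays consistent. *)
Lemma slide_step_new t s q x : (q < width s)%N ->
  let s' := result (slide_step g f tau t s) in
  let L := layers s t.-1 in
  let p a := (a * width s + q)%N in
  let F a := lval L (p a) + gain x (counts s (p a)) in
  exists a, [/\ lval (layers s' t) (q * kA + x)%N = F a,
                lseq (layers s' t) (q * kA + x)%N = x :: lseq L (p a)
              & forall b, F b <= F a].
Proof.
move=> lt_q; rewrite /slide_step /= eqxx.
pose p a := (a * width s + q)%N.
pose F a := lval (layers s t.-1) (p a) + gain x (counts s (p a)).
set l := loop _ _ _.
pose Q (L : layer R kA) := exists a,
  [/\ lval L (q * kA + x)%N = F a,
      lseq L (q * kA + x)%N = x :: lseq (layers s t.-1) (p a)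
    & forall b, F b <= F a].
suff: Q (result l) by [].
have bestP (r : nat) y : let G (a : 'I_kA) :=
     lval (layers s t.-1) (a * width s + r)%N + gain y (counts s (a * width s + r)%N) in
  exists a, [/\ a \in enum 'I_kA, result (loop (enum 'I_kA) (fun a best =>
      let* i := tick (a * width s)%N in
      let* p := tick (i + r)%N in
      let* v0 := get (lval (layers s t.-1)) p in
      let* h0 := get (lseq (layers s t.-1)) p in
      let* c0 := get (counts s) p in
      let* u := stage_payoff g f tau y c0 in
      let* v := tick (v0 + u) in
      keep_max best v h0) None) =
    Some (G a, lseq (layers s t.-1) (a * width s + r)%N)
  & forall b, b \in enum 'I_kA -> G b <= G a].
  move=> G; apply: (@loop_keep_max _ _ _ (enum 'I_kA) _ G).
    by move=> a b; rewrite /= result_stage_payoff.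
  by exists x; rewrite mem_enum.
(* The disjunction lets one claim serve twice: an iteration that hits the cell establishes [Q], any
   other one preserves it. *)
have Qnew r (y : 'I_kA) L : (r * kA + y = q * kA + x)%N \/ Q L -> Q (result (
    let* best := loop (enum 'I_kA) (fun a best =>
      let* i := tick (a * width s)%N in
      let* p := tick (i + r)%N in
      let* v0 := get (lval (layers s t.-1)) p in
      let* h0 := get (lseq (layers s t.-1)) p in
      let* c0 := get (counts s) p in
      let* u := stage_payoff g f tau y c0 in
      let* v := tick (v0 + u) in
      keep_max best v h0) None in
    if best is Some (v, h0) then
      let* h := tick (y :: h0) in
      let* i := tick (r * kA)%N in
      let* i := tick (i + y)%N in
      put L i v h
    else ret L)).
  move=> eqQ; have [a [_ e maxa]] := bestP r y.
  move: e; rewrite /bind => /= -> /=.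
  have [e|ne] := eqVneq (q * kA + x)%N (r * kA + y)%N.
    have [eq_qr eq_xy] := digit_inj e; subst r y.
    by exists a; rewrite /= !eqxx; split=> // b; apply: maxa; rewrite mem_enum.
  case: eqQ => [e|[b [e1 e2 maxb]]]; first by rewrite e eqxx in ne.
  by exists b; rewrite /= (negPf ne).
rewrite /l; apply: (@loop_reach _ _ Q _ q).
- by rewrite mem_iota.
- move=> L; apply: (@loop_reach _ _ Q _ x) => [||y L' _ QL].
  + by rewrite mem_enum.
  + by move=> L'; apply: Qnew; left.
  + by apply: Qnew; right.
- by move=> r L _ QL; apply: loop_stable => // y L' _ QL'; apply: Qnew; right.
Qed.

End ProgramSteps.

(** * Invariant of the filled layers *)

Section Correctness.
Variables (R : realType) (kA kB m : nat) (g : game R kA kB).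
Variables (f : count_rule R kA kB m) (tau : count_vec kA m -> nat).
Hypothesis m_gt0 : (0 < m)%N.
Implicit Types (x a : 'I_kA) (h : seq 'I_kA) (s : dp_state R kA).

(** The horizon of [dp_table] is the current [t], so only layers already written are constrained.
    [counts] is described for the current window length only, as each growing step replaces it. *)
Record dp_invariant (t : nat) s : Prop := DPInvariant {
  inv_width : width s = (kA ^ (minn m t).-1)%N;
  inv_counts : forall h, size h = minn m t ->
    counts s (code h) =1 (fun i => count_mem i h);
  inv_table : dp_table t g f (table_entry s);
  inv_aux : forall u h, (1 <= u <= t)%N -> size h = minn m u ->
    let x := aux_entry s u h in
    [/\ size x = u, drop (u - m) x = h & payoff g f x = table_entry s u h] }.

Lemma dp_invariant_first : dp_invariant 1 (result (first_step g f tau)).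
Proof.
have min1 : minn m 1 = 1%N by lia.
have sub1 : (1 - m = 0)%N by lia.
have firstP x := layers_first_step g f tau x.
set s := result _ in firstP *.
have entry1 x : table_entry s 1 [:: x] = ubarA g x (play f [::]).
  by rewrite /table_entry (_ : code [:: x] = x) //; have [-> _ _ _] := firstP x.
split.
- by rewrite min1.
- rewrite min1 => -[|x []] // _ i.
  rewrite (_ : code [:: x] = x) //; have [_ _ -> _] := firstP x.
  by rewrite /= addn0.
(* With horizon 1 both recursive clauses are vacuous, the sliding one because [m >= 1]. *)
- split=> [//|t h x|t h x]; lia.
- case=> [|[|u]] // h _; rewrite min1; case: h => [|x []] // _.
  rewrite /aux_entry (_ : code [:: x] = x) //; have [_ -> _ _] := firstP x.
  rewrite sub1 drop0 (payoff_rcons _ _ [::]) payoff_nil add0r entry1.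
  by [].
Qed.

(* The window forgets its oldest action exactly when [m <= t], hence the
   boolean used as a number in [drop]. *)
Lemma aux_rcons t s k x :
  (0 < t)%N -> dp_invariant t s -> size k = minn m t ->
  let y := rcons (aux_entry s t k) x in
  [/\ size y = t.+1, drop (t.+1 - m) y = rcons (drop (m <= t) k) x
    & payoff g f y = table_entry s t k + ubarA g x (play f k)].
Proof.
move=> t_gt0 [_ _ _ /(_ t k)]; rewrite t_gt0 leqnn => auxP sz_k.
have {auxP} [sz_y dy py] := auxP isT sz_k; rewrite /= size_rcons sz_y.
rewrite payoff_rcons sz_y dy py; split=> //.
rewrite drop_rcons ?sz_y; last by lia.
by rewrite -[in RHS]dy drop_drop; congr (rcons (drop _ _) _); lia.
Qed.

(** Shared by growing and sliding. In the last hypothesis [k] is an optimal predecessor window: [h]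
    itself while the window grows, [a :: h] for some action [a] once it slides. *)
Lemma dp_invariant_step t s s' :
  (0 < t)%N -> dp_invariant t s ->
  width s' = (kA ^ (minn m t.+1).-1)%N ->
  (forall h, size h = minn m t.+1 ->
    counts s' (code h) =1 (fun i => count_mem i h)) ->
  (forall u, u != t.+1 -> layers s' u = layers s u) ->
  (forall h x, size h = (minn m t.+1).-1 -> exists k,
    [/\ size k = minn m t, drop (m <= t) k = h,
        table_entry s' t.+1 (rcons h x) =
          table_entry s t k + ubarA g x (play f k),
        aux_entry s' t.+1 (rcons h x) = rcons (aux_entry s t k) x
      & forall k', size k' = minn m t -> drop (m <= t) k' = h ->
          table_entry s t k' + ubarA g x (play f k') <=
          table_entry s t k + ubarA g x (play f k)]) ->
  dp_invariant t.+1 s'.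
Proof.
move=> t_gt0 Is Ws' Cs' old new; have [_ _ tabs auxs] := Is.
have oldV u h : u != t.+1 -> table_entry s' u h = table_entry s u h.
  by move=> ne; rewrite /table_entry old.
split=> //.
  split=> [x|u h x u_m u_t sz_h|u h x].
  - by rewrite oldV; [rewrite (dp_first tabs) | lia].
  - have [eu|ne] := eqVneq u t.+1; last first.
      by rewrite !oldV; [apply: (dp_grow tabs) => //; lia | lia | lia].
    subst u; have [|k [_ dk -> _ _]] := new h x; first by lia.
    move: dk; rewrite (_ : (m <= t)%N = false) ?drop0; last by lia.
    by move=> ->; rewrite [in RHS]oldV //; lia.
  - case/andP=> lt_mu le_ut sz_h.
    have [eu|ne] := eqVneq u t.+1; last first.
      have [||[a ea] maxa] := @dp_slide _ _ _ _ _ _ _ _ tabs u h x; [lia|lia|].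
      rewrite oldV //; split=> [|b]; first by exists a; rewrite oldV //; lia.
      by rewrite oldV //; lia.
    subst u; have [|k [sz_k dk -> _ maxk]] := new h x; first by lia.
    (* The window slides, so the head [a] of [k] is the action that leaves it and the witness of the
       maximum. *)
    move: dk maxk; rewrite (_ : (m <= t)%N = true) /=; last by lia.
    case: k sz_k => [|a k]; first by move=> /=; lia.
    rewrite /= drop0 => sz_k -> maxk; split=> [|b].
      by exists a; rewrite oldV //; lia.
    rewrite oldV; last by lia.
    by apply: maxk; rewrite /= ?drop0 //; lia.
move=> u h u_t sz_h; have [eu|ne] := eqVneq u t.+1; last first.
  by rewrite oldV // /aux_entry old //; apply: auxs => //; lia.
subst u; case/lastP: h sz_h => [|h x]; first by move=> /=; lia.
rewrite size_rcons => sz_h.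
have [|k [sz_k dk -> -> _]] := new h x; first by lia.
by rewrite -dk; apply: aux_rcons.
Qed.

Lemma gain_counts t s h x : dp_invariant t s -> size h = minn m t ->
  ubarA g x (f (to_count_vec m (counts s (code h)))) = ubarA g x (play f h).
Proof.
by move=> Is sz_h; rewrite /play (to_count_vec_ext _ (inv_counts Is sz_h)).
Qed.

Lemma dp_invariant_grow t s : (0 < t < m)%N -> dp_invariant t s ->
  dp_invariant t.+1 (result (grow_step g f tau t.+1 s)).
Proof.
case/andP=> t_gt0 lt_tm Is.
have minE : minn m t = t by lia.
have minSE : minn m t.+1 = t.+1 by lia.
have ws : (width s * kA = kA ^ t)%N.
  by rewrite (inv_width Is) minE -expnSr prednK.
have newP h x : size h = t ->
  [/\ table_entry (result (grow_step g f tau t.+1 s)) t.+1 (rcons h x) =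
        table_entry s t h + ubarA g x (play f h),
      aux_entry (result (grow_step g f tau t.+1 s)) t.+1 (rcons h x) =
        rcons (aux_entry s t h) x
    & forall j, counts (result (grow_step g f tau t.+1 s)) (code (rcons h x)) j =
        ((x == j) + count_mem j h)%N].
  move=> sz_h; have lt_h : (code h < width s * kA)%N.
    by rewrite ws -sz_h code_lt.
  rewrite /table_entry /aux_entry !code_rcons.
  have [-> -> cE] := grow_step_new g f tau t.+1 x lt_h.
  rewrite (gain_counts x Is) ?minE // rev_cons; split=> // j.
  by rewrite cE (inv_counts Is) ?minE.
apply: (dp_invariant_step t_gt0 Is).
- by rewrite minSE.
- rewrite minSE; case/lastP=> // h x; rewrite size_rcons => -[sz_h] j.
  by have [_ _ ->] := newP h x sz_h; rewrite -cats1 count_cat /= addn0 addnC.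
- exact: grow_step_other.
rewrite minSE minE leqNgt lt_tm /= => h x sz_h.
have [-> -> _] := newP h x sz_h.
by exists h; rewrite drop0; split=> // k; rewrite drop0 => _ ->.
Qed.

Lemma dp_invariant_slide t s : (m <= t)%N -> dp_invariant t s ->
  dp_invariant t.+1 (result (slide_step g f tau t.+1 s)).
Proof.
move=> le_mt Is; have t_gt0 : (0 < t)%N by apply: leq_trans le_mt.
have minE : minn m t = m by lia.
have minSE : minn m t.+1 = m by lia.
have ws : width s = (kA ^ m.-1)%N by rewrite (inv_width Is) minE.
apply: (dp_invariant_step t_gt0 Is).
- by rewrite minSE.
(* Windows have length [m] before and after the step, so [counts] carries over unchanged. *)
- by rewrite minSE => h sz_h; apply: (inv_counts Is); rewrite minE.
- exact: slide_step_other.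
rewrite minSE minE le_mt /= => h x sz_h.
have lt_h : (code h < width s)%N by rewrite ws -sz_h code_lt.
have sz_ah a : size (a :: h) = m by rewrite /= sz_h prednK.
(* [width s] is the weight of the most significant digit, so this address is that of the window with
   [a] prepended. *)
have codeE a : (a * width s + code h)%N = code (a :: h).
  by rewrite code_cons ws sz_h.
have [a [vE hE maxa]] := slide_step_new g f tau t.+1 x lt_h.
exists (a :: h); rewrite /= drop0; split=> //.
- exact: sz_ah.
- by rewrite /table_entry code_rcons vE codeE (gain_counts x Is) // minE.
- by rewrite /aux_entry code_rcons hE codeE rev_cons.
case=> [|b k]; first by move=> /=; lia.
move=> _; rewrite /= drop0 => ->.
by have := maxa b; rewrite !codeE !(gain_counts x Is) ?minE.
Qed.

(** Each address costs an iteration, a read and a comparison; the final reversal costs two steps for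
    each of the [T] stored actions, a length given by the invariant; three single operations
    remain. *)
Lemma best_entryP T s : (0 < kA)%N -> (0 < T)%N -> dp_invariant T s ->
  exists h : (minn m T).-tuple 'I_kA,
    [/\ result (best_entry T s) = Some (table_entry s T h, aux_entry s T h),
        forall h' : (minn m T).-tuple 'I_kA,
          table_entry s T h' <= table_entry s T h
      & (steps (best_entry T s) <= 3 * (kA ^ minn m T) + 2 * T + 3)%N].
Proof.
move=> kA_gt0 T_gt0 Is; set l := minn m T.
have ws : (width s * kA = kA ^ l)%N.
  by rewrite (inv_width Is) -expnSr prednK // /l; lia.
rewrite /best_entry /= ws.
set best := loop _ _ _.
have [i [lt_i bestE maxi]] : exists i, [/\ i \in iota 0 (kA ^ l),
    result best = Some (lval (layers s T) i, i)
  & forall j, j \in iota 0 (kA ^ l) -> lval (layers s T) j <= lval (layers s T) i].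
  apply: (@loop_keep_max _ _ _ _ _ _ id) => //.
  by exists 0%N; rewrite mem_iota expn_gt0 kA_gt0.
have [|h /eqP sz_h code_h] := @code_surj kA l i; first by rewrite mem_iota in lt_i.
have steps_best : (steps best <= 3 * (kA ^ l))%N.
  apply: leq_trans (_ : _ <= size (iota 0 (kA ^ l)) * 3)%N _.
    by apply: steps_loop_le.
  by rewrite size_iota mulnC.
rewrite bestE /=; exists (Tuple sz_h) => /=.
have loopE (r z : seq 'I_kA) :
    result (loop r (fun a z => tick (a :: z)) z) = catrev r z.
  by elim: r z => //= a r IHr z; rewrite IHr.
split.
- by rewrite loopE /table_entry /aux_entry code_h.
- move=> h'; rewrite /table_entry code_h; apply: maxi.
  by rewrite mem_iota /= -[in X in (_ < X)%N](size_tuple h') code_lt.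
have [||sz_x _ _] := @inv_aux _ _ Is T h; [by rewrite T_gt0 leqnn|exact/eqP|].
move: sz_x; rewrite /aux_entry size_rev code_h => sz_x.
have : (steps (loop (lseq (layers s T) i) (fun a z => tick (a :: z)) [::]) <= T * 2)%N.
  by rewrite -[in X in (_ <= X)%N]sz_x; apply: steps_loop_le.
by lia.
Qed.

End Correctness.

(** * Step counts *)

Section Cost.

(** Budget form of sequencing: spending at most [a] out of [n] leaves [n - a], with [a <= n]
    guarding against truncated subtraction. *)
Lemma steps_bind_le (A B : Type) (a n : nat) (p : timed A) (k : A -> timed B) :
  (steps p <= a)%N -> (a <= n)%N -> (forall v, (steps (k v) <= n - a)%N) ->
  (steps (bind p k) <= n)%N.
Proof. by move=> pa an /(_ (result p)); rewrite /=; lia. Qed.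

Lemma steps_bind_tick (A B : Type) (n : nat) (v : A) (k : A -> timed B) :
  (0 < n)%N -> (steps (k v) <= n.-1)%N -> (steps (bind (tick v) k) <= n)%N.
Proof. by rewrite /=; lia. Qed.

Variables (R : realType) (cf kA kB m : nat) (g : game R kA kB).
Variables (f : count_rule R kA kB m) (tau : count_vec kA m -> nat).
Hypotheses (kA_gt0 : (0 < kA)%N) (kB_gt0 : (0 < kB)%N).
Hypothesis tauP : forall c, (tau c <= cf * (kA * kB))%N.
Implicit Types (x : 'I_kA) (c : array 'I_kA nat) (s : dp_state R kA).

Let N := (kA * kB)%N.

Lemma leq_kA_N : (kA <= N)%N. Proof. by rewrite leq_pmulr. Qed.
Lemma leq_kB_N : (kB <= N)%N. Proof. by rewrite leq_pmull. Qed.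

(** [cf * N] pays for the query; each of the [kB] iterations takes five steps: the iteration itself,
    two reads, a product and a sum. *)
Lemma steps_stage_payoff x c :
  (steps (stage_payoff g f tau x c) <= (cf + 5) * N)%N.
Proof.
apply: (steps_bind_le (a := cf * N)) => [||beta].
- exact: tauP.
- by rewrite leq_mul2r; lia.
apply: leq_trans (_ : _ <= kB * 5)%N _.
  rewrite -[X in (_ <= X * _)%N](size_enum_ord kB).
  exact: steps_loop_le.
have := leq_kB_N; rewrite /N; lia.
Qed.

Lemma steps_empty_count : (steps (empty_count kA) <= 2 * kA)%N.
Proof.
rewrite mulnC -[X in (_ <= X * _)%N](size_enum_ord kA).
exact: steps_loop_le.
Qed.

Lemma steps_push_count c x : (steps (push_count c x) <= 6 * N)%N.
Proof.
have H := leq_kA_N.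
apply: (@steps_bind_le _ _ (kA * 3)) => [||d].
- rewrite -[X in (_ <= X * _)%N](size_enum_ord kA).
  exact: steps_loop_le.
- by lia.
by rewrite /=; lia.
Qed.

Lemma steps_first_step : (steps (first_step g f tau) <= (cf + 20) * (kA * N))%N.
Proof.
have H := leq_kA_N; have N1 : (N <= kA * N)%N by rewrite leq_pmull.
rewrite /first_step.
apply: (steps_bind_le steps_empty_count) => [|c0]; first by lia.
apply: (@steps_bind_le _ _ (kA * ((cf + 17) * N))) => [||LC]; last 2 first.
- by lia.
- by rewrite /=; lia.
apply: leq_trans (_ : _ <= kA * ((cf + 16) * N).+1)%N _; last by lia.
rewrite -[X in (_ <= X * _)%N](size_enum_ord kA).
apply: steps_loop_le => x LC'.
apply: (steps_bind_le (steps_stage_payoff _ _)) => [|u]; first by lia.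
apply: steps_bind_tick; first by lia.
apply: (@steps_bind_le _ _ 2) => [//||L]; first by lia.
apply: (steps_bind_le (steps_push_count _ _)) => [|d]; first by lia.
by rewrite /=; lia.
Qed.

Lemma steps_grow_step t s :
  (0 < width s)%N ->
  (steps (grow_step g f tau t s) <= (cf + 30) * (width s * kA * kA * N))%N.
Proof.
move=> w_gt0.
have H := leq_kA_N; have N1 : (N <= kA * N)%N by rewrite leq_pmull.
have N2 : (kA * N <= width s * kA * (kA * N))%N.
  by rewrite leq_pmull // muln_gt0 w_gt0.
rewrite /grow_step.
do 3! [apply: steps_bind_tick; first by lia].
set w := (width s * kA)%N in N2 *.
(* Each loop level raises the coefficient by one, which absorbs the iteration step because [kA] and
   [N] are positive. *)
apply: (@steps_bind_le _ _ (w * ((cf + 25) * (kA * N)))) => [||LC]; last 2 first.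
- by lia.
- by rewrite /=; lia.
apply: leq_trans (_ : _ <= w * ((cf + 24) * (kA * N)).+1)%N _; last first.
  by rewrite leq_mul2l; apply/orP; right; lia.
rewrite -[X in (_ <= X * _)%N](size_iota 0 w).
apply: steps_loop_le => p LC.
apply: leq_trans (_ : _ <= kA * ((cf + 23) * N).+1)%N _; last by lia.
rewrite -[X in (_ <= X * _)%N](size_enum_ord kA).
apply: steps_loop_le => x LC'.
do 3! [apply: steps_bind_tick; first by lia].
apply: (steps_bind_le (steps_stage_payoff _ _)) => [|u]; first by lia.
do 4! [apply: steps_bind_tick; first by lia].
apply: (@steps_bind_le _ _ 2) => [//||L]; first by lia.
apply: (steps_bind_le (steps_push_count _ _)) => [|d]; first by lia.
by rewrite /=; lia.
Qed.

(** The nested loops visit [width s * kA * kA] triples of a retained suffix, a new action and a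
    leaving action, each at a cost of O(N). *)
Lemma steps_slide_step t s :
  (0 < width s)%N ->
  (steps (slide_step g f tau t s) <= (cf + 30) * (width s * kA * kA * N))%N.
Proof.
move=> w_gt0; set w := width s in w_gt0 *.
have H := leq_kA_N; have N1 : (N <= kA * N)%N by rewrite leq_pmull.
have N2 : (kA * N <= kA * (kA * N))%N by rewrite leq_pmull.
have N3 : (kA * (kA * N) <= w * (kA * (kA * N)))%N by rewrite leq_pmull.
rewrite /slide_step.
do 2! [apply: steps_bind_tick; first by lia].
apply: (@steps_bind_le _ _ (w * ((cf + 25) * (kA * (kA * N))))) => [||L]; last 2 first.
- by lia.
- by rewrite /=; lia.
apply: leq_trans (_ : _ <= w * ((cf + 24) * (kA * (kA * N))).+1)%N _; last first.
  by rewrite leq_mul2l; apply/orP; right; lia.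
rewrite -[X in (_ <= X * _)%N](size_iota 0 w).
apply: steps_loop_le => q L.
apply: leq_trans (_ : _ <= kA * ((cf + 23) * (kA * N)).+1)%N _; last by lia.
rewrite -[X in (_ <= X * _)%N](size_enum_ord kA).
apply: steps_loop_le => x L'.
apply: (@steps_bind_le _ _ ((cf + 16) * (kA * N))) => [||best]; last 2 first.
- by lia.
- by case: best => [[v h0]|] /=; lia.
apply: leq_trans (_ : _ <= kA * ((cf + 15) * N).+1)%N _; last by lia.
rewrite -[X in (_ <= X * _)%N](size_enum_ord kA).
apply: steps_loop_le => a best.
do 5! [apply: steps_bind_tick; first by lia].
apply: (steps_bind_le (steps_stage_payoff _ _)) => [|u]; first by lia.
by rewrite /=; lia.
Qed.

(** Correctness and cost share one induction on [T], because the cost of a step depends on [width],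
    which the invariant determines. Beyond [cf + 30] for a step, two units cover the iteration and
    the test [t <= m]. *)
Lemma fill_tableP T : (0 < m)%N ->
  dp_invariant g f T.+1 (result (fill_table g f tau T.+1)) /\
  (steps (fill_table g f tau T.+1) <= (cf + 32) * (kA ^ (m + 2) * kB * T.+1))%N.
Proof.
move=> m_gt0; set K := (kA ^ (m + 2) * kB)%N.
have K_gt0 : (0 < K)%N by rewrite muln_gt0 expn_gt0 kA_gt0.
(* The factors are the width at full window length, the new action, the leaving action and the scale
   [N] of one stage payoff. *)
have KE : K = (kA ^ m.-1 * kA * kA * N)%N.
  by rewrite /K /N addn2 !expnSr -[in LHS](prednK m_gt0) expnSr; lia.
elim: T => [|T [IT stepsT]].
  split; first exact: dp_invariant_first.
  rewrite /fill_table /= addn0 muln1.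
  apply: leq_trans steps_first_step _; apply: leq_mul; first by lia.
  by rewrite KE -mulnA leq_pmull // muln_gt0 expn_gt0 kA_gt0.
have fillE : let p := fill_table g f tau T.+1 in
    let p' := if (T.+2 <= m)%N then grow_step g f tau T.+2 (result p)
              else slide_step g f tau T.+2 (result p) in
    result (fill_table g f tau T.+2) = result p' /\
    steps (fill_table g f tau T.+2) = (steps p + (steps p').+2)%N.
  rewrite /fill_table.
  have -> : iota 2 T.+2.-1 = rcons (iota 2 T) T.+2.
    by rewrite -cats1 -(iotaD 2 T 1) addn1.
  have [rE sE] := loop_rcons (iota 2 T) T.+2 (fun t s =>
    let* b := tick (t <= m)%N in
    if b then grow_step g f tau t s else slide_step g f tau t s)
    (result (first_step g f tau)).
  by split; [exact: rE | rewrite [LHS]/= sE /=; lia].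
have [-> ->] := fillE; move: IT stepsT.
set s := result _; set n := steps _ => Is le_n.
have w_gt0 : (0 < width s)%N by rewrite (inv_width Is) expn_gt0 kA_gt0.
have le_wK : (width s * kA * kA * N <= K)%N.
  rewrite KE (inv_width Is) -!mulnA leq_mul2r leq_pexp2l ?orbT //; lia.
have {}le_wK : ((cf + 30) * (width s * kA * kA * N) <= (cf + 30) * K)%N.
  by rewrite leq_mul2l le_wK orbT.
have [le_Tm|lt_mT] := leqP T.+2 m.
  split; first exact: dp_invariant_grow.
  have := leq_trans (steps_grow_step T.+2 w_gt0) le_wK; lia.
split; first exact: dp_invariant_slide.
have := leq_trans (steps_slide_step T.+2 w_gt0) le_wK; lia.
Qed.

End Cost.

(** * Optimality, running time and recovery of an optimal sequence *)

Theorem theorem2 (R : realType) (cf : nat) :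
  exists C : nat,
  forall (kA kB m T : nat) (g : game R kA kB) (f : count_rule R kA kB m)
         (tau : count_vec kA m -> nat),
    (0 < kA)%N -> (0 < kB)%N -> (1 <= m)%N -> (1 <= T)%N ->
    (forall c, (tau c <= cf * (kA * kB))%N) ->
    let run := solve g f tau T in
    let s := (result run).1 in
    let out := (result run).2 in
    [/\ forall V : nat -> seq 'I_kA -> R, dp_table T g f V ->
          exists v : R,
            is_max_of (fun h : (minn m T).-tuple 'I_kA => V T h) v /\
            is_max_of (fun x : T.-tuple 'I_kA => payoff g f x) v,
        dp_table T g f (table_entry s),
        (steps run <= C * (kA ^ (m + 2) * kB * T))%N,
        forall (t : nat) (h : seq 'I_kA),
          (1 <= t <= T)%N -> size h = minn m t ->
          let x := aux_entry s t h in
          [/\ size x = t, drop (t - m) x = h & payoff g f x = table_entry s t h]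
      & exists (v : R) (x : T.-tuple 'I_kA),
          [/\ out = Some (v, tval x),
              payoff g f x = v,
              is_max_of (fun h : (minn m T).-tuple 'I_kA => table_entry s T h) v
            & is_max_of (fun y : T.-tuple 'I_kA => payoff g f y) v]].
Proof.
(* Filling takes [cf + 32]; the other 8 cover the [3 * kA ^ minn m T + 2 * T + 3] steps of the final
   scan, as [kA ^ minn m T], [T] and 1 are each at most [kA ^ (m + 2) * kB * T]. *)
exists (cf + 40)%N => kA kB m T g f tau kA_gt0 kB_gt0 m_gt0 T_gt0 tauP run s out.
have [Is le_s] : dp_invariant g f T s /\
    (steps (fill_table g f tau T) <= (cf + 32) * (kA ^ (m + 2) * kB * T))%N.
  by case: T T_gt0 @run @s @out => // T _; apply: fill_tableP.
have lTT : (1 <= T <= T)%N by rewrite T_gt0 leqnn.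
have [h [outE maxh le_b]] := best_entryP m_gt0 kA_gt0 T_gt0 Is.
have max_s : is_max_of (fun h : (minn m T).-tuple 'I_kA => table_entry s T h)
    (table_entry s T h) by split=> //; exists h.
have [/eqP sz_x _ px] := inv_aux Is lTT (size_tuple h).
split.
- move=> V VP.
  have [v maxv] := is_max_of_exists (fun h : (minn m T).-tuple 'I_kA => V T h) h.
  by exists v; split=> //; apply: dp_table_is_max maxv.
- exact: inv_table Is.
- have -> : steps run = (steps (fill_table g f tau T) +
      (steps (best_entry T s) + 0))%N by [].
  have K1 : (kA ^ minn m T <= kA ^ (m + 2) * kB)%N.
    apply: leq_trans (leq_pmulr _ kB_gt0).
    by rewrite leq_pexp2l //; lia.
  have K2 : (0 < kA ^ (m + 2) * kB)%N by rewrite muln_gt0 expn_gt0 kA_gt0.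
  move: K1 K2 le_s le_b; set K := (kA ^ (m + 2) * kB)%N => K1 K2 le_s le_b.
  have K3 : (K <= K * T)%N by rewrite leq_pmulr.
  have K4 : (T <= K * T)%N by rewrite leq_pmull.
  by lia.
- exact: inv_aux Is.
exists (table_entry s T h), (Tuple sz_x); split=> //.
exact: dp_table_is_max (inv_table Is) max_s.
Qed.
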